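(* Let $\ell,m,\ell',m'$ be positive integers such that \[ \ell m=\ell' m', \qquad \ell\le \ell'\le m'\le m. \] Then \[ \tau(\ell,m)\le \tau(\ell',m'). \]
   Context: For a positive integer $r$, $P_r$ denotes the path graph on $r$ vertices. For positive integers $\ell,m$, the rectangular grid graph $R_{\ell,m}=P_\ell \square P_m$ is the Cartesian product of $P_\ell$ and $P_m$ (the $\ell\times m$ grid). For a finite connected graph $G$, $\tau(G)$ denotes the number of spanning trees of $G$, and $\tau(\ell,m)=\tau(R_{\ell,m})$. *)

(* Defs.v *)
From mathcomp Require Import all_boot.

Set Implicit Arguments.
Unset Strict Implicit.
Unset Printing Implicit Defensive.

Record sgraph := SGraph {
  svertex :> finType;
  sedge : rel svertex;
  sedge_sym : symmetric sedge;
  sedge_irrefl : irreflexive sedge }.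

Definition path_rel (r : nat) : rel 'I_r :=
  [rel i j : 'I_r | (i.+1 == j :> nat) || (j.+1 == i :> nat)].

Lemma path_rel_sym r : symmetric (@path_rel r).
Proof. by move=> i j; rewrite /path_rel /= orbC. Qed.

Lemma path_rel_irrefl r : irreflexive (@path_rel r).
Proof. by move=> i; rewrite /path_rel /= orbb gtn_eqF. Qed.

Definition path_graph (r : nat) : sgraph :=
  SGraph (@path_rel_sym r) (@path_rel_irrefl r).

Definition box_rel (G H : sgraph) : rel (G * H) :=
  [rel u v : G * H | (u.1 == v.1) && sedge u.2 v.2
                     || (u.2 == v.2) && sedge u.1 v.1].

Lemma box_rel_sym (G H : sgraph) : symmetric (@box_rel G H).
Proof.
move=> u v; rewrite /box_rel /=.
by rewrite (eq_sym u.1) (eq_sym u.2) (sedge_sym u.1) (sedge_sym u.2).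
Qed.

Lemma box_rel_irrefl (G H : sgraph) : irreflexive (@box_rel G H).
Proof. by move=> u; rewrite /box_rel /= !sedge_irrefl !andbF. Qed.

Definition box (G H : sgraph) : sgraph :=
  SGraph (@box_rel_sym G H) (@box_rel_irrefl G H).

Definition grid (l m : nat) : sgraph := box (path_graph l) (path_graph m).

Definition edge_set (G : sgraph) : {set {set G}} :=
  [set [set x; y] | x in [set: G], y in [set: G] & sedge x y].

(* Adjacency in the graph whose edges are the two-element members of F. *)
Definition set_rel (T : finType) (F : {set {set T}}) : rel T :=
  [rel x y : T | (x != y) && ([set x; y] \in F)].

Definition connected (T : finType) (e : rel T) : bool :=
  [forall x : T, forall y : T, connect e x y].

(* The cycles of a simple graph are the duplicate-free closed paths on at
   least three vertices: [ucycle] also accepts [:: x; y] when x and y are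
   adjacent.  The bound on the length loses nothing (see acyclicP). *)
Definition acyclic (T : finType) (e : rel T) : bool :=
  [forall n : 'I_#|T|.+1, forall c : n.-tuple T, (2 < n) ==> ~~ ucycleb e c].

Lemma acyclicP (T : finType) (e : rel T) :
  reflect (forall c : seq T, 2 < size c -> ~ ucycle e c) (acyclic e).
Proof.
apply: (iffP forallP) => [acy c c_gt2 cyc | acy n].
  have /card_uniqP szc := ucycle_uniq cyc.
  have le_c : size c < #|T|.+1 by rewrite ltnS -szc max_card.
  have /forallP/(_ (in_tuple c)) := acy (Ordinal le_c).
  by rewrite /= c_gt2 /= => /negP; apply.
apply/forallP => c; apply/implyP => n_gt2; apply/negP.
by apply: acy; rewrite size_tuple.
Qed.

(* A spanning subgraph has all of G as vertices, so it is given by its edges. *)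
Definition spanning_tree (G : sgraph) (F : {set {set G}}) : bool :=
  [&& F \subset edge_set G, connected (set_rel F) & acyclic (set_rel F)].

Definition tau (G : sgraph) : nat := #|[set F : {set {set G}} | spanning_tree F]|.

(* Main.v *)
Require Import Defs.
From mathcomp Require Import all_boot all_order all_fingroup all_algebra.
From mathcomp Require Import mxtens Rstruct reals trigo.
From mathcomp Require Import ring lra zify.

Set Implicit Arguments.
Unset Strict Implicit.
Unset Printing Implicit Defensive.

(* By the matrix-tree theorem and the discrete cosine transform,
     tau(l, m) = \prod_(1 <= i < l) (X_i^m - X_i^-m) / (X_i - X_i^-1),
   where X_i > 1 solves X + X^-1 = 4 - 2 cos (pi i / l).  Put B = (1 + sqrt 2)^2
   and g_l = B \prod_i X_i^2.  Since \prod_i (X_i - X_i^-1)^2 = l U_l with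
   U_l = (B^l - B^-l) / (B - B^-1), up to the factors 1 - X_i^-(2m) one has
     tau(l, m)^2 = (g_l / B)^m / (l U_l).
   For l <= m those factors have product at least 3/4, so that the theorem reduces
   to two facts.
   (1) g_l^(1/l) increases with l.  The same formula for the transposed grid gives
   tau(l, n)^2 n U_n = \prod_j (Y_j^l - Y_j^-l)^2, whose l-th root increases with
   l factor by factor; taking n-th roots as n tends to infinity yields (1).
   (2) If d = (l + m) - (l' + m') then (l' - l)(m' - l) = l d, hence l'/l <= 1 + d,
   and the gain B^d from the shorter perimeter beats the loss 16/9 (1 + d). *)

(** * Rooted forests encoded by parent functions *)

Lemma eq_set2 (T : finType) (a b x y : T) :
  [set a; b] = [set x; y] -> (a = x /\ b = y) \/ (a = y /\ b = x).
Proof.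
move=> E.
have /set2P ain : a \in [set x; y] by rewrite -E set21.
have /set2P bin : b \in [set x; y] by rewrite -E set22.
have /set2P xin : x \in [set a; b] by rewrite E set21.
have /set2P yin : y \in [set a; b] by rewrite E set22.
by case: ain => ?; case: bin => ?; case: xin => ?; case: yin => ?; subst; auto.
Qed.

Section ParentFunctions.
Variable T : finType.
Implicit Types (p q : {ffun T -> option T}) (a b r x y : T).

(** [None] is absorbing under [obind p], so this excludes cycles: p is a rooted forest whose roots
    are the vertices with value [None]. *)
Definition rooted p := [forall a, fconnect (obind p) (Some a) None].

Definition depth p a := findex (obind p) (Some a) None.

Definition parent_edges p : {set {set T}} :=
  [set [set u.1; u.2] | u in [pred u : T * T | p u.1 == Some u.2]].

Lemma mem_parent_edges p x y :
  ([set x; y] \in parent_edges p) = (p x == Some y) || (p y == Some x).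
Proof.
apply/imsetP/orP => [[[a b]] /eqP /= pab /eq_set2 [] [-> ->]|[]/eqP pxy].
- by left; apply/eqP.
- by right; apply/eqP.
- by exists (x, y); rewrite ?inE /= ?pxy.
- by exists (y, x); rewrite ?inE /= ?pxy // setUC.
Qed.

Lemma depth_parent p a b : rooted p -> p a = Some b -> depth p a = (depth p b).+1.
Proof.
move=> /forallP/(_ a) conn pab.
by rewrite /depth (fconnect_findex conn) //= pab.
Qed.

Lemma rooted_ind p (P : T -> Prop) : rooted p ->
  (forall a, (forall b, p a = Some b -> P b) -> P a) -> forall a, P a.
Proof.
move=> rp IH a; move: {2}(depth p a) (leqnn (depth p a)) => n.
elim: n a => [|n IHn] a.
  by rewrite leqn0 findex_eq0.
by move=> da; apply: IH => b pab; apply: IHn; rewrite (depth_parent rp pab) in da.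
Qed.

Lemma connected_parent_edges p r :
  rooted p -> (forall a, p a = None -> a = r) ->
  connected (set_rel (parent_edges p)).
Proof.
move=> rp pr.
have toR a : connect (set_rel (parent_edges p)) a r.
  move: a; apply: (rooted_ind rp) => a IH; case pa: (p a) => [b|]; last by rewrite (pr a).
  apply: connect_trans (IH b pa); apply: connect1.
  rewrite /set_rel /= mem_parent_edges pa eqxx andbT.
  by apply/eqP => ab; move: (depth_parent rp pa); rewrite ab => /n_Sn.
have sym : connect_sym (set_rel (parent_edges p)).
  by apply: sym_connect_sym => x y; rewrite /set_rel /= eq_sym setUC.
apply/forallP => x; apply/forallP => y.
by apply: connect_trans (toR x) _; rewrite sym.
Qed.

(* A deepest vertex of a cycle would have two distinct parents. *)
Lemma acyclic_parent_edges p : rooted p -> acyclic (set_rel (parent_edges p)).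
Proof.
move=> rp; apply/acyclicP => c c_gt2 /andP[cyc unq].
have [x0 x0c] : exists x0, x0 \in c by case: (c) c_gt2 => // x s _; exists x; rewrite mem_head.
have [x xc xmax] := arg_maxnP (depth p) x0c.
have up y : y \in c -> set_rel (parent_edges p) x y -> p x = Some y.
  move=> yc; rewrite /set_rel /= mem_parent_edges => /andP[_ /orP[/eqP //|/eqP pyx]].
  by have /= := xmax y yc; rewrite (depth_parent rp pyx) /= ltnn.
have [i s rots] := rot_to xc.
move: cyc unq c_gt2; rewrite -(rot_cycle i) -(rot_uniq i) -(size_rot i) rots.
have sub y : y \in x :: s -> y \in c by rewrite -rots mem_rot.
case: s {rots} sub => [//|y s] sub.
case: (lastP s) sub => [//|s' z] sub /= .
rewrite rcons_path last_rcons => /andP[exy /andP[_ ezx]] /andP[_ /andP[yz _]] _.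
have pxy : p x = Some y by apply: up => //; apply: sub; rewrite !inE eqxx orbT.
have pxz : p x = Some z.
  apply: up; first by apply: sub; rewrite !inE mem_rcons inE eqxx !orbT.
  by move: ezx; rewrite /set_rel /= eq_sym setUC.
by move: yz; rewrite mem_rcons inE; case: pxy pxz => -> [] ->; rewrite eqxx.
Qed.

(** Induction along p: if q reversed the edge from v to its parent w, then p, which agrees with q at
    w, would make v and w parents of each other. *)
Lemma parent_edges_inj p q r :
  rooted p -> p r = None -> q r = None ->
  (forall a, a != r -> p a) -> (forall a, a != r -> q a) ->
  parent_edges p = parent_edges q -> p = q.
Proof.
move=> rp pr qr ptot qtot E; apply/ffunP => v.
move: v; apply: (rooted_ind rp) => v.
have [->|vr] := eqVneq v r; first by rewrite pr qr.
case pv: (p v) (ptot v vr) => [w|//] _ IH.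
have := mem_parent_edges q v w; rewrite -E mem_parent_edges pv eqxx /=.
move=> /esym/orP[/eqP ->//|/eqP qw].
by have := depth_parent rp pv; have := IH w erefl; rewrite qw => /(depth_parent rp) -> => /eqP;
   rewrite -[X in X == _]addn0 -addn2 eqn_add2l.
Qed.

End ParentFunctions.

(** * Spanning trees as arborescences towards a fixed root *)

Lemma closer_neighbor (T : finType) (e : rel T) (r : T) : connected e ->
  exists d : T -> nat, forall a, a != r -> exists2 b, e a b & d b < d a.
Proof.
move=> con.
pose Q a k := [exists t : k.-tuple T, path e a t && (last a t == r)].
have exQ a : exists k, Q a k.
  have /connectP[t pt rt] := forallP (forallP con a) r.
  by exists (size t); apply/existsP; exists (in_tuple t); rewrite /= pt -rt eqxx.
(* The witness is the distance to r: the second vertex of a shortest path from a is closer. *)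
exists (fun a => ex_minn (exQ a)) => a ar.
case: (ex_minnP (exQ a)) => n /existsP[[t /= /eqP szt] /andP[pt /eqP lt]] _.
case: t szt pt lt => [|b t] /= szt; first by move=> _ ae; rewrite ae eqxx in ar.
move=> /andP[eab pt] lt; exists b => //.
case: ex_minnP => m _ mmin; rewrite -szt ltnS; apply: mmin.
by apply/existsP; exists (in_tuple t); rewrite /= pt lt eqxx.
Qed.

Section RootedTrees.
Variables (G : sgraph) (r : G).
Implicit Types (p : {ffun G -> option G}) (F : {set {set G}}).

Definition arborescence p := rooted p &&
  [forall a, if p a is Some b then sedge a b else a == r].

(** Following parents ends at a vertex without a parent, and only r may be one. *)
Lemma arborescence_root p : arborescence p -> p r = None.
Proof.
case/andP=> rp /forallP edges.
apply: (rooted_ind (P := fun=> p r = None) rp) r => a IH.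
have := edges a; case pa: (p a) => [b|]; first by move=> _; apply: IH pa.
by move/eqP => <-.
Qed.

Lemma arborescence_total p : arborescence p -> forall a, a != r -> p a.
Proof.
by case/andP=> rp /forallP edges a ar; have := edges a; case: (p a) => // /eqP E; rewrite E eqxx in ar.
Qed.

Lemma spanning_tree_parent_edges p : arborescence p -> spanning_tree (parent_edges p).
Proof.
case/andP=> rp /forallP edges; apply/and3P; split.
- apply/subsetP => E /imsetP[[a b] /eqP /= pab ->]; apply/imset2P.
  apply: (Imset2spec (x1 := a) (x2 := b)); rewrite ?inE //=; by have := edges a; rewrite pab /=.
- apply: (connected_parent_edges rp (r := r)) => a pa.
  by have := edges a; rewrite pa => /eqP.
- exact: acyclic_parent_edges.
Qed.

(** Every vertex other than r chooses an F-neighbour closer to r. The chosen edges form a spanning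
    tree, and a further edge of F would close a cycle with a path in that tree. *)
Lemma spanning_tree_arborescence F : spanning_tree F ->
  exists2 p, arborescence p & parent_edges p = F.
Proof.
case/and3P=> /subsetP sub con /acyclicP acy.
have edgeF x y : [set x; y] \in F -> x != y /\ sedge x y.
  move/sub/imset2P => [a b _]; rewrite !inE /= => ab /eq_set2 E.
  have ab' : a != b by apply/eqP => E'; rewrite E' /= sedge_irrefl in ab.
  by case: E => -[-> ->]; split=> //; rewrite 1?eq_sym 1?sedge_sym.
have [d dP] := closer_neighbor r con.
pose p := [ffun a => if a == r then None else
                     [pick b | set_rel F a b && (d b < d a)]].
have pP a b : p a = Some b -> set_rel F a b /\ d b < d a.
  rewrite ffunE; case: eqP => // _; case: pickP => // c /andP[Fac dc] [<-].
  by split.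
have pr a : p a = None -> a = r.
  rewrite ffunE; case: eqP => // /eqP ar; case: pickP => // nob.
  by have [b eab dab] := dP a ar; have := nob b; rewrite eab dab.
have rp : rooted p.
  apply/forallP => a; move: {2}(d a) (leqnn (d a)) => n.
  elim: n a => [|n IHn] a da; case pa: (p a) => [b|]; rewrite fconnect_eqVf /= pa ?connect0 //.
    by have [_] := pP _ _ pa; rewrite ltnNge (leq_trans da).
  by apply: IHn; rewrite -ltnS; apply: leq_trans da; case: (pP _ _ pa).
have arb : arborescence p.
  rewrite /arborescence rp; apply/forallP => a; case pa: (p a) => [b|].
    by have [/andP[_ /edgeF[]]] := pP _ _ pa.
  by rewrite (pr a).
exists p => //.
have subF : {subset parent_edges p <= F}.
  by move=> E /imsetP[[a b] /eqP /= /pP[/andP[_ ?] _] ->].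
apply/eqP; rewrite eqEsubset; apply/andP; split; first exact/subsetP.
apply/subsetP => E EF; apply/negPn/negP => ET.
have /imset2P[x y _] := sub E EF; rewrite !inE /= => xy Exy; rewrite {}Exy in EF ET.
have [nxy _] := edgeF x y EF.
have /and3P[_ /forallP/(_ x)/forallP/(_ y) + _] := spanning_tree_parent_edges arb.
case/connectP=> q0 /shortenP[q pq uq _] ly.
apply: (acy (x :: q)).
  case: q pq ly {uq} => [|z [|w q]] //=; first by move=> _ yx; rewrite yx eqxx in nxy.
  by rewrite andbT => /andP[_ xz] yz; rewrite -yz (negPf ET) in xz.
rewrite /ucycle uq andbT /= rcons_path -ly.
rewrite /set_rel /= eq_sym nxy setUC EF !andbT.
by apply: sub_path pq => a b /andP[/= -> /subF].
Qed.

(** Each spanning tree has exactly one orientation towards r, so the count is the same for every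
    r. *)
Lemma card_arborescence : #|[set p | arborescence p]| = tau G.
Proof.
rewrite /tau -(card_in_imset (f := @parent_edges G)).
  apply: eq_card => F; rewrite inE; apply/imsetP/idP => [[p]|].
    by rewrite inE => arb ->; apply: spanning_tree_parent_edges.
  by case/spanning_tree_arborescence => p arb <-; exists p; rewrite ?inE.
move=> p q; rewrite !inE => arbp arbq.
have /andP[rp _] := arbp.
apply: (parent_edges_inj (r := r)) => //; first exact: arborescence_root.
- exact: arborescence_root.
- exact: arborescence_total.
- exact: arborescence_total.
Qed.

End RootedTrees.

Import Order.TTheory GRing.Theory Num.Theory.
Local Open Scope ring_scope.

(** * Determinants of parent functions and the matrix-tree theorem *)

Section FunctionalDeterminant.
Variables (K : idomainType) (T : finType) (n : nat) (phi : 'I_n -> T).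
Hypothesis phi_bij : bijective phi.
Implicit Type p : {ffun T -> option T}.

Let fmat p : 'M[K]_n :=
  \matrix_(i, j) ((i == j)%:R - (p (phi i) == Some (phi j))%:R).

(* If some vertex never reaches None, the indicator of all such vertices is in
   the kernel. *)
Let det_fmat_unrooted p : ~~ rooted p -> \det (fmat p) = 0.
Proof.
rewrite negb_forall => /existsP[a bad]; have [psi phiK psiK] := phi_bij.
pose u : 'cV[K]_n :=
  \col_j (~~ fconnect (obind p) (Some (phi j)) None)%:R.
have ker : fmat p *m u = 0.
  apply/colP => i; rewrite !mxE.
  under eq_bigr => j _ do rewrite !mxE mulrBl.
  rewrite sumrB (bigD1 i) //= big1 ?addr0; last first.
    by move=> j /negPf ji; rewrite eq_sym ji mul0r.
  rewrite eqxx mul1r fconnect_eqVf /=; case pi: (p (phi i)) => [b|] /=; last first.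
    by rewrite connect0 big1 ?subr0 // => j _; rewrite mul0r.
  rewrite (bigD1 (psi b)) //= psiK eqxx mul1r big1 ?addr0 ?subrr // => j.
  case: (Some b =P Some (phi j)) => [[bj]|_]; last by rewrite mul0r.
  by rewrite bj phiK eqxx.
have := congr1 (mulmx (\adj (fmat p))) ker.
rewrite mulmxA mul_adj_mx mulmx0 mul_scalar_mx => /colP/(_ (psi a)).
by rewrite !mxE psiK bad mulr1.
Qed.

(* A permutation contributing to the Leibniz sum follows p on the points it
   moves, and an orbit of p that ends in None leaves no moved point. *)
Let det_fmat_rooted p : rooted p -> \det (fmat p) = 1.
Proof.
move=> rp; have phiI := bij_inj phi_bij.
rewrite /determinant (bigD1 (1%g : 'S_n)) //= [X in _ + X]big1 ?addr0 => [|s s1].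
  rewrite odd_perm1 expr0 mul1r big1 // => i _; rewrite !mxE perm1 eqxx.
  case: eqP => [pi|]; rewrite ?subr0 //.
  by have /n_Sn := depth_parent rp pi.
apply/eqP; rewrite mulf_eq0 prodf_seq_eq0 orbC; apply/orP; left.
apply: contraR s1 => nz; apply/eqP/permP => i; rewrite perm1.
have moved j : s j != j -> p (phi j) = Some (phi (s j)).
  move=> sj; apply/eqP; apply: contraR nz => psj; apply/hasP; exists j.
    by rewrite mem_index_enum.
  by rewrite !mxE [j == _]eq_sym (negPf sj) (negPf psj) subrr /=.
have [psi phiK psiK] := phi_bij.
suff H a : s (psi a) = psi a by rewrite -(phiK i) H.
move: a; apply: (rooted_ind rp) => a IH.
apply/eqP; apply/negPn/negP => sa; have := moved _ sa; rewrite psiK.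
by move/IH; rewrite phiK => /perm_inj E; rewrite E eqxx in sa.
Qed.

Lemma det_functional p : \det (fmat p) = (rooted p)%:R.
Proof. by case: (boolP (rooted p)) => [/det_fmat_rooted|/det_fmat_unrooted]. Qed.

(** Each row is a weighted sum over the possible parents k of its vertex. Multilinearity expands the
    determinant over all parent functions, and [det_functional] keeps the rooted ones. *)
Lemma det_weighted_functional (w : T -> option T -> K) :
  \det (\matrix_(i, j) \sum_k w (phi i) k * ((i == j)%:R - (k == Some (phi j))%:R))
    = \sum_(p : {ffun T -> option T} | rooted p) \prod_a w a (p a).
Proof.
have [psi phiK psiK] := phi_bij.
rewrite [RHS]big_mkcond /=.
under [RHS]eq_bigr => p _.
  have -> : (if rooted p then \prod_a w a (p a) else 0) =
            (\prod_a w a (p a)) * \det (fmat p).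
    by rewrite det_functional; case: rooted; rewrite ?mulr1 ?mulr0.
  rewrite /determinant mulr_sumr.
  over.
rewrite exchange_big /determinant /=; apply: eq_bigr => s _.
under eq_bigr => i _ do rewrite mxE.
rewrite (reindex psi) /=; last by exists phi => ? _; rewrite ?psiK ?phiK.
rewrite bigA_distr_bigA mulr_sumr; apply: eq_bigr => p _.
rewrite mulrCA; congr (_ * _).
rewrite big_split /=; congr (_ * _).
  by apply: eq_bigr => a _; rewrite psiK.
rewrite (reindex phi) /=; last by exists psi => ? _; rewrite ?psiK ?phiK.
by apply: eq_bigr => i _; rewrite mxE phiK.
Qed.

End FunctionalDeterminant.

Lemma big_option (V : nmodType) (T : finType) (F : option T -> V) :
  \sum_k F k = F None + \sum_k F (Some k).
Proof.
rewrite (bigD1 None) //=; congr (_ + _).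
rewrite (reindex_omap Some id) => [|[a|]] //=.
by apply: eq_bigl => a; rewrite eqxx.
Qed.

Section MatrixTree.
Variables (R : idomainType) (G : sgraph) (n : nat) (phi : 'I_n -> G).

(** Written as a sum over the neighbours k, to match the rows of [det_weighted_functional]. *)
Definition laplacian : 'M[R]_n := \matrix_(i, j)
  \sum_k (sedge (phi i) k)%:R * ((phi i == phi j)%:R - (k == phi j)%:R).

Hypothesis phi_bij : bijective phi.

Let none_count (p : {ffun G -> option G}) := #|[pred a | p a == None]|.

Let valid (p : {ffun G -> option G}) :=
  [forall a, if p a is Some b then sedge a b else true].

(** At most one summand is 1, since the root of an arborescence is its only vertex without a
    parent. *)
Let sum_roots p : (\sum_r arborescence r p)%N = [&& rooted p, valid p & none_count p == 1%N].
Proof.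
have arbP r : arborescence r p -> [&& rooted p, valid p & none_count p == 1%N].
  move=> arb; have /andP[-> /forallP edges] := arb; rewrite /=; apply/andP; split.
    by apply/forallP => a; have := edges a; case: (p a).
  rewrite /none_count (eq_card (B := pred1 r)) ?card1 // => a; rewrite !inE.
  apply/eqP/eqP => [pa|->]; last exact: arborescence_root.
  by have := edges a; rewrite pa => /eqP.
case: (boolP [&& _, _ & _]) => [|H]; last first.
  by apply: big1 => r _; case: (boolP (arborescence r p)) => // /arbP; rewrite (negPf H).
case/and3P=> rp /forallP edges /eqP/mem_card1[r0 r0P].
rewrite (bigD1 r0) //= big1 => [|r rr0].
  suff -> : arborescence r0 p by [].
  rewrite /arborescence rp; apply/forallP => a; have := edges a.
  by have := r0P a; rewrite !inE; case: (p a) => //= <-.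
case: (boolP (arborescence r p)) => // /arborescence_root pr.
by have := r0P r; rewrite !inE pr eqxx (negPf rr0).
Qed.

(** In det (X + L) an edge to a parent has weight 1 and a root has weight X, so this polynomial
    counts rooted spanning forests by their number of roots. Its linear coefficient counts spanning
    trees with a chosen root. *)
Theorem matrix_tree : (char_poly (- laplacian))`_1 = (n * tau G)%:R.
Proof.
pose w (a : G) (k : option G) : {poly R} :=
  if k is Some b then (sedge a b)%:R else 'X.
have -> : char_poly (- laplacian) =
    \sum_(p : {ffun G -> option G} | rooted p) \prod_a w a (p a).
  rewrite -(det_weighted_functional phi_bij); congr (\det _); apply/matrixP => i j.
  rewrite !mxE big_option /= subr0 polyCN opprK mulr_natr; congr (_ + _).
  rewrite rmorph_sum; apply: eq_bigr => k _ /=.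
  by rewrite polyCM polyCB !polyC_natr (bij_eq phi_bij).
have wE (p : {ffun G -> option G}) : \prod_a w a (p a) = (valid p)%:R * 'X^(none_count p).
  case: (boolP (valid p)) => [/forallP edges|].
    rewrite mul1r /none_count -sum1_card -prodrXr [RHS]big_mkcond /=.
    apply: eq_bigr => a _; have := edges a; rewrite /w inE.
    by case: (p a) => [b ->|] //=; rewrite expr1.
  rewrite mul0r negb_forall => /existsP[a].
  by rewrite (bigD1 a) //= /w; case: (p a) => // b /negPf ->; rewrite mul0r.
rewrite coef_sum.
transitivity (\sum_(p : {ffun G -> option G}) (\sum_r arborescence r p)%N%:R : R).
  rewrite [LHS]big_mkcond; apply: eq_bigr => p _; rewrite sum_roots wE.
  case: rooted => //; case: valid; rewrite ?mul0r ?coef0 // mul1r coefXn /=.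
  by rewrite eq_sym.
rewrite -natr_sum exchange_big /=; congr (_%:R).
rewrite (eq_bigr (fun=> tau G)) => [|r _].
  by rewrite sum_nat_const -(card_ord n) (bij_eq_card phi_bij).
by rewrite -(card_arborescence r) -sum1dep_card [RHS]big_mkcond.
Qed.

End MatrixTree.

(** * Spectra of the path and grid Laplacians *)

Lemma char_poly_conj (F : fieldType) n (P A B : 'M[F]_n) :
  P \in unitmx -> P *m A = B *m P -> char_poly A = char_poly B.
Proof.
move=> Pu PA; have PuX : \det (map_mx polyC P) != 0.
  by rewrite det_map_mx polyC_eq0 -unitfE -unitmxE.
apply: (mulfI PuX); rewrite [RHS]mulrC -!det_mulmx; congr (\det _).
by rewrite /char_poly_mx mulmxBr mulmxBl mul_mx_scalar mul_scalar_mx -!map_mxM PA.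
Qed.

Section GridSpectrum.
Variable R : realType.
Implicit Types l m : nat.
Local Notation pi := (@pi R).

Definition path_eigenvalue l k : R := 2 - 2 * cos (pi * k%:R / l%:R).
Local Notation lam := path_eigenvalue.

Lemma lam0 l : lam l 0 = 0.
Proof. by rewrite /path_eigenvalue mulr0 mul0r cos0 mulr1 subrr. Qed.

Lemma angle_itv l k : (k <= l)%N -> (0 : R) <= pi * k%:R / l%:R <= pi.
Proof.
move=> kl; have pi0 := pi_ge0 R; apply/andP; split.
  by rewrite divr_ge0 ?mulr_ge0.
case: l kl => [|l] kl; first by rewrite invr0 mulr0.
by rewrite ler_pdivrMr ?ltr0n // ler_wpM2l // ler_nat.
Qed.

Lemma angle_inj l j k : (0 < l)%N -> pi * j%:R / l%:R = pi * k%:R / l%:R :> R -> j = k.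
Proof.
move=> l0 /mulIf; rewrite invr_neq0 ?pnatr_eq0 -?lt0n // => /(_ isT) /mulfI.
by rewrite gt_eqF ?pi_gt0 // => /(_ isT) /eqP; rewrite eqr_nat => /eqP.
Qed.

Lemma lam_inj l j k : (j < l)%N -> (k < l)%N -> lam l j = lam l k -> j = k.
Proof.
move=> jl kl; have l0 := leq_ltn_trans (leq0n _) jl.
move=> /addrI/oppr_inj/mulfI; rewrite pnatr_eq0 => /(_ isT) /cos_inj.
by move=> E; apply: (angle_inj l0); apply: E; rewrite in_itv /= angle_itv // ltnW.
Qed.

Section Path.
Variable l : nat.

Definition path_laplacian : 'M[R]_l := @laplacian R (path_graph l) l id.

Lemma path_laplacian_sym : path_laplacian^T = path_laplacian.
Proof.
apply/matrixP => i j; rewrite !mxE /=.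
have rowE (a b : 'I_l) :
    \sum_(k < l) (path_rel a k)%:R * ((a == b)%:R - (k == b)%:R)
  = (a == b)%:R * (\sum_(k < l) (path_rel a k)%:R) - (path_rel a b)%:R :> R.
  rewrite mulr_sumr; under eq_bigr => k _ do rewrite mulrBr mulrC.
  rewrite sumrB; congr (_ - _); rewrite (bigD1 b) //= eqxx mulr1 big1 ?addr0 //.
  by move=> k /negPf ->; rewrite mulr0.
rewrite !rowE path_rel_sym [i == j]eq_sym; congr (_ - _).
by case: eqP => [->|]; rewrite ?mul0r.
Qed.

Lemma mul_path_laplacian (u : 'I_l -> R) j :
  \sum_i u i * path_laplacian i j = \sum_(k < l) (path_rel j k)%:R * (u j - u k).
Proof.
under eq_bigr => i _ do rewrite -path_laplacian_sym !mxE /= mulr_sumr.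
rewrite exchange_big /=; apply: eq_bigr => k _.
under eq_bigr => i _ do rewrite mulrCA mulrBr.
rewrite -mulr_sumr sumrB; congr (_ * (_ - _)).
  by rewrite (bigD1 j) //= eqxx mulr1 big1 ?addr0 // => i /negPf ij; rewrite eq_sym ij mulr0.
by rewrite (bigD1 k) //= eqxx mulr1 big1 ?addr0 // => i /negPf ij; rewrite eq_sym ij mulr0.
Qed.

Lemma sum_path_rel (F : nat -> R) (j : 'I_l) :
  \sum_(k < l) (path_rel j k)%:R * F k =
    (if (j.+1 < l)%N then F j.+1 else 0) + (if (0 < j)%N then F j.-1 else 0).
Proof.
transitivity (\sum_(k < l) ((j.+1 == k :> nat)%:R * F k + (k.+1 == j :> nat)%:R * F k)).
  apply: eq_bigr => k _; rewrite -mulrDl /path_rel /=; congr (_ * _).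
  case: eqP => [E|_]; last by rewrite add0r.
  by rewrite -E gtn_eqF ?addr0 // ltnS leqnSn.
rewrite big_split /=; congr (_ + _).
  case: ltnP => jl.
    rewrite (bigD1 (Ordinal jl)) //= eqxx mul1r big1 ?addr0 // => k.
    by rewrite -val_eqE /= eq_sym => /negPf ->; rewrite mul0r.
  by apply: big1 => k _; rewrite gtn_eqF ?mul0r // (leq_trans (ltn_ord k)).
case: (posnP j) => [->|j0]; first by apply: big1 => k _; rewrite mul0r.
have j1 : (j.-1 < l)%N by rewrite (leq_ltn_trans (leq_pred j)).
rewrite (bigD1 (Ordinal j1)) //= prednK // eqxx mul1r big1 ?addr0 // => k.
rewrite -val_eqE /= => /eqP kj; case: eqP => [E|]; last by rewrite mul0r.
by case: kj; rewrite -E.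
Qed.

(* Eigenvectors of the path Laplacian: the discrete cosine transform (DCT-II). *)
Definition dct : 'M[R]_l :=
  \matrix_(k, x) cos (x.*2.+1%:R * (pi * k%:R / (l.*2)%:R)).

Definition lam_mx : 'M[R]_l := diag_mx (\row_k lam l k).

Lemma dct_laplacian : dct *m path_laplacian = lam_mx *m dct.
Proof.
apply/matrixP => k j; rewrite mul_diag_mx !mxE.
have l0 : (0 < l)%N := leq_ltn_trans (leq0n _) (ltn_ord j).
under eq_bigr => i _ do rewrite mxE.
rewrite (mul_path_laplacian (fun i : 'I_l => cos (i.*2.+1%:R * (pi * k%:R / (l.*2)%:R)))).
set t : R := pi * k%:R / (l.*2)%:R.
have -> : lam l k = 2 - 2 * cos (t *+ 2).
  rewrite /path_eigenvalue; congr (2 - 2 * cos _); rewrite /t -mul2n natrM.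
  by field; rewrite !pnatr_eq0 -lt0n l0.
have dS i : i.*2.+1%:R = 2 * i%:R + 1 :> R by rewrite -natr1 -mul2n natrM.
pose F (i : nat) : R := cos (j.*2.+1%:R * t) - cos (i.*2.+1%:R * t).
rewrite (sum_path_rel F).
(* At the last vertex the missing neighbour would contribute 0 anyway: (2l + 1) t and (2l - 1) t are
   symmetric about 2 l t = pi k, where the sine vanishes. *)
have -> : (if (j.+1 < l)%N then F j.+1 else 0) = F j.+1.
  case: ltnP => // jl; have {jl} E : j.+1 = l by apply/eqP; rewrite eqn_leq ltn_ord.
  have lR : l%:R = j%:R + 1 :> R by have := congr1 (fun n => n%:R : R) E; rewrite -natr1.
  have lt : 2 * l%:R * t = pi * k%:R.
    by rewrite /t -mul2n natrM; field; rewrite pnatr_eq0 -lt0n.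
  rewrite /F !dS -[j.+1%:R]natr1 -lR.
  have -> : 2 * j%:R + 1 = 2 * l%:R - 1 :> R by rewrite lR; ring.
  rewrite [(_ - 1) * t]mulrBl [(_ + 1) * t]mulrDl !mul1r lt cosB cosD.
  suff -> : sin (pi * k%:R) = 0 :> R by rewrite !mul0r addr0 subr0 subrr.
  by elim: (k : nat) => [|n IH]; rewrite ?mulr0 ?sin0 // -natr1 mulrDr mulr1 sinDpi IH oppr0.
(* At the first vertex the missing neighbour is absorbed by the evenness of the cosine. *)
have -> : (if (0 < j)%N then F j.-1 else 0) =
   cos (j.*2.+1%:R * t) - cos (j.*2.+1%:R * t - t *+ 2).
  case: (posnP j) => [->|j0].
    by rewrite double0 mul1r (_ : t - t *+ 2 = - t) ?cosN ?subrr //; ring.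
  have jR : j%:R = j.-1%:R + 1 :> R by rewrite natr1 prednK.
  by rewrite /F; congr (_ - cos _); rewrite !dS jR; ring.
have -> : F j.+1 = cos (j.*2.+1%:R * t) - cos (j.*2.+1%:R * t + t *+ 2).
  by rewrite /F; congr (_ - cos _); rewrite !dS -natr1; ring.
rewrite cosD cosB; ring.
Qed.

(** The Laplacian is symmetric, so [dct *m dct^T] commutes with [lam_mx]; the eigenvalues being
    distinct, it is diagonal. Its diagonal entries are sums of squares, positive because the entry
    cos (pi k / (2 l)) of column 0 is. *)
Lemma dct_unit : (0 < l)%N -> dct \in unitmx.
Proof.
move=> l0.
have sym : lam_mx *m (dct *m dct^T) = (dct *m dct^T) *m lam_mx.
  rewrite mulmxA -dct_laplacian -mulmxA -[in LHS]path_laplacian_sym -trmx_mul.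
  by rewrite dct_laplacian trmx_mul tr_diag_mx mulmxA.
have diag : is_diag_mx (dct *m dct^T).
  apply/is_diag_mxP => i j ij; move: sym => /matrixP/(_ i j).
  rewrite mul_diag_mx mul_mx_diag => /eqP.
  rewrite mxE [X in _ == X]mxE !mxE mulrC -subr_eq0 -mulrBr mulf_eq0 => /orP[/eqP //|].
  rewrite subr_eq0 => /eqP/lam_inj E; case/eqP: ij.
  exact: E.
have nz : \det (dct *m dct^T) != 0.
  rewrite det_trig; last exact: is_diag_mx_is_trig.
  apply/prodf_neq0 => k _.
  rewrite mxE psumr_neq0 => [|x _]; last by rewrite [dct^T _ _]mxE -expr2 sqr_ge0.
  apply/hasP; exists (Ordinal l0); first by rewrite mem_index_enum.
  rewrite [dct^T _ _]mxE mxE -expr2 /= exprn_gt0 // mul1r cos_gt0_pihalf //.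
  have pi0 := pi_gt0 R; apply/andP; split.
    by apply: (@lt_le_trans _ _ 0); rewrite ?oppr_lt0 ?divr_gt0 // divr_ge0 // mulr_ge0 // ltW.
  rewrite -mul2n natrM -mulrA ltr_pM2l // ltr_pdivrMr ?mulr_gt0 ?ltr0n //.
  by rewrite mulrA mulVf ?pnatr_eq0 // mul1r ltr_nat.
by rewrite unitmxE unitfE; move: nz; rewrite det_mulmx mulf_eq0 negb_or => /andP[].
Qed.

End Path.
End GridSpectrum.

Section GridLaplacian.
Variable R : realType.
Variables l m : nat.
Local Notation phi := (@mxtens_unindex l m).
Local Notation lam := (path_eigenvalue R).

Lemma mxtens_unindex_bij : bijective phi.
Proof. by exists (@mxtens_index l m); [exact: mxtens_unindexK | exact: mxtens_indexK]. Qed.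

Lemma sum_delta (V : pzSemiRingType) (T : finType) (a : T) (F : T -> V) :
  \sum_k (a == k)%:R * F k = F a.
Proof.
rewrite (bigD1 a) //= eqxx mul1r big1 ?addr0 // => k.
by rewrite eq_sym => /negPf ->; rewrite mul0r.
Qed.

Lemma grid_laplacian : @laplacian R (grid l m) (l * m) phi =
  tensmx (path_laplacian R l) 1%:M + tensmx 1%:M (path_laplacian R m).
Proof.
apply/matrixP => i j; rewrite !mxE.
case: (phi i) (phi j) => a b [c d] /=.
pose H (k : 'I_l * 'I_m) : R := ((a == c) && (b == d))%:R - ((k.1 == c) && (k.2 == d))%:R.
transitivity (\sum_(k1 < l) \sum_(k2 < m)
   ((a == k1)%:R * ((path_rel b k2)%:R * H (k1, k2)) +
    (b == k2)%:R * ((path_rel a k1)%:R * H (k1, k2)))).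
  rewrite pair_big; apply: eq_bigr => -[k1 k2] _ /=.
  rewrite !mulrA -mulrDl; congr (_ * _).
  rewrite /box_rel /= -!natrM -natrD !mulnb; congr (_%:R).
  (* A path has no loops, so the two kinds of adjacency exclude each other and their indicators add
     up. *)
  case: (eqVneq a k1) => [->|_]; case: (eqVneq b k2) => [->|_] /=;
    rewrite ?path_rel_irrefl ?addn0 ?orbF //.
have splitE (k1 : 'I_l) : \sum_(k2 < m)
     ((a == k1)%:R * ((path_rel b k2)%:R * H (k1, k2)) +
      (b == k2)%:R * ((path_rel a k1)%:R * H (k1, k2))) =
   (a == k1)%:R * \sum_(k2 < m) (path_rel b k2)%:R * H (k1, k2) +
   (path_rel a k1)%:R * H (k1, b).
  by rewrite big_split /= sum_delta mulr_sumr.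
rewrite (eq_bigr _ (fun k1 _ => splitE k1)).
rewrite big_split /= sum_delta addrC; congr (_ + _).
  rewrite mulr_suml; apply: eq_bigr => k1 _; rewrite -mulrA; congr (_ * _).
  by rewrite /H /= mulrBl -!natrM !mulnb.
rewrite mulr_sumr; apply: eq_bigr => k2 _; rewrite mulrCA; congr (_ * _).
by rewrite /H /= mulrBr -!natrM !mulnb.
Qed.

Lemma grid_char_poly : (0 < l)%N -> (0 < m)%N ->
  char_poly (- @laplacian R (grid l m) (l * m) phi) =
  \prod_(0 <= i < l) \prod_(0 <= j < m) ('X + (lam l i + lam m j)%:P).
Proof.
move=> l0 m0.
pose D : 'M[R]_(l * m) :=
  diag_mx (\row_k (lam l (phi k).1 + lam m (phi k).2)).
have Du : tensmx (dct R l) (dct R m) \in unitmx.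
  by apply: tensmx_unit; rewrite -?lt0n // dct_unit.
rewrite (@char_poly_conj _ _ (tensmx (dct R l) (dct R m)) _ (- D)) //; last first.
  rewrite mulmxN mulNmx; congr (- _); rewrite grid_laplacian mulmxDr !tensmx_mul.
  rewrite !dct_laplacian !mulmx1.
  by rewrite /lam_mx /D !mul_diag_mx; apply/matrixP => i j; rewrite !mxE; ring.
rewrite char_poly_trig; last first.
  apply/is_trig_mxP => i j ij; rewrite !mxE -val_eqE /= ltn_eqF //.
  by rewrite mulr0n oppr0.
rewrite big_mkord; under [RHS]eq_bigr => i _ do rewrite big_mkord.
rewrite pair_big /= (reindex phi) /=; last exact: onW_bij mxtens_unindex_bij.
by apply: eq_bigr => k _; rewrite !mxE eqxx mulr1n polyCN opprK.
Qed.

(* The spanning tree count is read off the coefficient of X, whose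
   factor X comes from the eigenvalue lam l 0 + lam m 0 = 0. *)
Lemma tau_grid_prod : (0 < l)%N -> (0 < m)%N ->
  (l * m)%:R * (tau (grid l m))%:R =
  (\prod_(1 <= j < m) lam m j) *
  \prod_(1 <= i < l) \prod_(0 <= j < m) (lam l i + lam m j).
Proof.
move=> l0 m0; rewrite -natrM -(@matrix_tree R (grid l m) _ phi mxtens_unindex_bij) grid_char_poly //.
rewrite big_ltn // [X in X * _]big_ltn // !lam0 addr0 polyC0 addr0 -mulrA coefXM /=.
rewrite -horner_coef0 hornerM !horner_prod; congr (_ * _).
  by apply: eq_bigr => j _; rewrite hornerD hornerX hornerC add0r add0r.
apply: eq_bigr => i _; rewrite horner_prod.
by apply: eq_bigr => j _; rewrite hornerD hornerX hornerC add0r.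
Qed.

End GridLaplacian.

(** * Chebyshev polynomials and the product formula for the count *)

Section Chebyshev.
Variable R : realType.
Local Notation pi := (@pi R).
Local Notation lam := (path_eigenvalue R).

(* cheb n.+1 is the monic Chebyshev polynomial of the second kind of degree n. *)
Fixpoint cheb n : {poly R} :=
  match n with
  | 0 => 0
  | n1.+1 => if n1 is n2.+1 then 'X * cheb n1 - cheb n2 else 1
  end.

Lemma chebSS n : cheb n.+2 = 'X * cheb n.+1 - cheb n.
Proof. by []. Qed.

Lemma nat_ind2 (P : nat -> Prop) : P 0 -> P 1 ->
  (forall n, P n -> P n.+1 -> P n.+2) -> forall n, P n.
Proof.
move=> P0 P1 PS n; suff: P n /\ P n.+1 by case.
by elim: n => [|n [Pn PSn]]; split=> //; apply: PS.
Qed.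

Lemma cheb_cos n t : (cheb n).[2 * cos t] * sin t = sin (n%:R * t).
Proof.
elim/nat_ind2: n => [||n IH1 IH2].
- by rewrite horner0 !mul0r sin0.
- by rewrite hornerC !mul1r.
rewrite chebSS hornerD hornerN hornerM hornerX mulrBl -mulrA IH1 IH2.
have -> : n.+2%:R * t = n.+1%:R * t + t by rewrite -natr1; ring.
have -> : n%:R * t = n.+1%:R * t - t by rewrite -natr1; ring.
by rewrite sinB sinD; ring.
Qed.

Lemma cheb_geom n x : x != 0 ->
  (cheb n).[x + x^-1] * (x - x^-1) = x ^+ n - x ^- n.
Proof.
move=> x0; elim/nat_ind2: n => [||n IH1 IH2].
- by rewrite horner0 mul0r expr0 invr1 subrr.
- by rewrite hornerC mul1r !expr1.
rewrite chebSS hornerD hornerN hornerM hornerX mulrBl -mulrA IH1 IH2.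
by rewrite -!exprVn !exprS; field.
Qed.

Lemma cheb_at2 n : (cheb n).[2] = n%:R.
Proof.
elim/nat_ind2: n => [||n IH1 IH2]; rewrite ?horner0 ?hornerC //.
by rewrite chebSS hornerD hornerN hornerM hornerX IH1 IH2 -!natr1; ring.
Qed.

Lemma cheb_monic_size n : size (cheb n.+1) = n.+1 /\ cheb n.+1 \is monic.
Proof.
elim/nat_ind2: n => [||n [s1 m1] [s2 m2]].
- by rewrite size_poly1 monic1.
- by rewrite chebSS /= mulr1 subr0 size_polyX monicX.
have sX : size ('X * cheb n.+2) = n.+3 by rewrite mulrC size_mulX ?monic_neq0 ?s2.
have lt : (size (- cheb n.+1) < size ('X * cheb n.+2)%R)%N by rewrite size_polyN s1 sX.
by rewrite chebSS size_polyDl // monicE lead_coefDl // lead_coefM lead_coefX mul1r sX.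
Qed.

(** By [cheb_cos] the numbers 2 cos (pi j / m) with 0 < j < m are roots. They are distinct, as the
    path eigenvalues are, and as many as the degree of this monic polynomial. *)
Lemma cheb_prod m : (0 < m)%N ->
  cheb m = \prod_(1 <= j < m) ('X - (2 * cos (pi * j%:R / m%:R))%:P).
Proof.
case: m => // n _; have [sz mon] := cheb_monic_size n.
pose rs := [seq 2 * cos (pi * j%:R / n.+1%:R) | j <- index_iota 1 n.+1].
have urs : uniq rs.
  rewrite map_inj_in_uniq ?iota_uniq // => i j; rewrite !mem_index_iota => /andP[_ i_n] /andP[_ jn].
  by move=> E; apply: (@lam_inj R n.+1) => //; rewrite /path_eigenvalue E.
have -> : \prod_(1 <= j < n.+1) ('X - (2 * cos (pi * j%:R / n.+1%:R))%:P) =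
    \prod_(z <- rs) ('X - z%:P) by rewrite /rs big_map.
rewrite -[RHS]scale1r -(monicP mon); apply: all_roots_prod_XsubC.
- by rewrite size_map size_iota sz subn1.
- apply/allP => z /mapP[j]; rewrite mem_index_iota => /andP[j0 jn] ->.
  rewrite /root; have := cheb_cos n.+1 (pi * j%:R / n.+1%:R).
  have -> : n.+1%:R * (pi * j%:R / n.+1%:R) = pi * j%:R by rewrite mulrC divfK ?pnatr_eq0.
  have -> : sin (pi * j%:R) = 0.
    by elim: (j) => [|k IH]; rewrite ?mulr0 ?sin0 // -natr1 mulrDr mulr1 sinDpi IH oppr0.
  move/eqP; rewrite mulf_eq0 => /orP[//|]; rewrite gt_eqF // sin_gt0_pi //.
  have pi0 := pi_gt0 R; rewrite divr_gt0 ?mulr_gt0 ?ltr0n //=.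
  by rewrite ltr_pdivrMr ?ltr0n // ltr_pM2l // ltr_nat.
- by rewrite uniq_rootsE.
Qed.

Lemma prod_add_lam m x : (0 < m)%N ->
  \prod_(1 <= j < m) (x + lam m j) = (cheb m).[2 + x].
Proof.
move=> m0; rewrite cheb_prod // horner_prod; apply: eq_bigr => j _.
by rewrite hornerXsubC /path_eigenvalue; ring.
Qed.

Lemma prod_lam m : (0 < m)%N -> \prod_(1 <= j < m) lam m j = m%:R.
Proof.
move=> m0; rewrite -[RHS]cheb_at2 -[2]addr0 -prod_add_lam //.
by apply: eq_bigr => j _; rewrite add0r.
Qed.

(** The factors with i = 0 multiply to m and those with j = 0 to l, which cancels the factor l m of
    [tau_grid_prod]. *)
Lemma tau_grid_cheb l m : (0 < l)%N -> (0 < m)%N ->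
  (tau (grid l m))%:R = \prod_(1 <= i < l) (cheb m).[2 + lam l i].
Proof.
move=> l0 m0; apply: (@mulfI _ (l * m)%:R).
  by rewrite pnatr_eq0 -lt0n muln_gt0 l0.
rewrite (tau_grid_prod R l0 m0) prod_lam // natrM [_%:R * _%:R]mulrC -mulrA; congr (_ * _).
rewrite -[l%:R]prod_lam // -big_split /=; apply: eq_bigr => i _.
by rewrite big_ltn // lam0 addr0 prod_add_lam.
Qed.

(** Both sides are the product of [lam l i + lam m j] over all positive i and j. *)
Lemma tau_gridC l m : (0 < l)%N -> (0 < m)%N ->
  tau (grid l m) = tau (grid m l).
Proof.
move=> l0 m0; apply/eqP; rewrite -(eqr_nat R) !tau_grid_cheb //; apply/eqP.
under eq_bigr => i _ do rewrite -prod_add_lam //.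
under [RHS]eq_bigr => i _ do rewrite -prod_add_lam //.
by rewrite exchange_big_nat; apply: eq_bigr => j _; apply: eq_bigr => i _; rewrite addrC.
Qed.

End Chebyshev.

(** * Inequalities between powers *)

Lemma ge_expn_bounded (R : archiRealFieldType) (a b c d : R) :
  0 < a -> 0 < b -> 0 < c ->
  (forall n, (0 < n)%N -> a ^+ n * c <= b ^+ n * d) -> a <= b.
Proof.
move=> a0 b0 c0 H; rewrite leNgt; apply/negP => ba.
have e0 : 0 < a / b - 1 by rewrite subr_gt0 ltr_pdivlMr // mul1r.
(* Chosen by the Archimedean property so that Bernoulli's lower bound for (a / b)^n exceeds d / c;
   the successor makes n positive. *)
pose n := (Num.bound (d / c / (a / b - 1))).+1.
have bern : forall k, 1 + k%:R * (a / b - 1) <= (a / b) ^+ k.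
  elim=> [|k IH]; first by rewrite mul0r addr0 expr0.
  have r0 : 0 <= a / b by rewrite ltW // divr_gt0.
  rewrite exprS; apply: le_trans (ler_wpM2l r0 IH); rewrite -natr1.
  have : 0 <= k%:R * (a / b - 1) ^+ 2 by rewrite mulr_ge0 ?sqr_ge0.
  by lra.
have := H n isT; rewrite leNgt => /negP; apply.
have bn0 : 0 < b ^+ n by rewrite exprn_gt0.
suff : d / c < (a / b) ^+ n.
  rewrite expr_div_n ltr_pdivlMr // mulrAC ltr_pdivrMr //.
  by rewrite mulrC.
apply: lt_le_trans (bern n).
have : d / c / (a / b - 1) < n%:R.
  have [dc|dc] := leP 0 (d / c / (a / b - 1)).
    apply: lt_trans (archi_boundP dc) _; by rewrite ltr_nat.
  by apply: lt_le_trans dc _.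
rewrite ltr_pdivrMr // => h; lra.
Qed.

(* With q = y^-2 this says that (1 - q^l)^(1/l) increases with l. *)
Lemma expn_sub_mono (R : realFieldType) (y : R) l l' : 1 < y -> (l <= l')%N ->
  (y ^+ l - y ^- l) ^+ l' <= (y ^+ l' - y ^- l') ^+ l.
Proof.
move=> y1 ll'; have y0 : 0 < y by apply: lt_trans y1.
have yN0 : y != 0 by rewrite gt_eqF.
pose q := y ^- 2.
have q0 : 0 <= q by rewrite invr_ge0 sqr_ge0.
have q1 : q <= 1 by rewrite invf_le1 ?exprn_gt0 // exprn_ege1 // ltW.
have E k : y ^+ k - y ^- k = y ^+ k * (1 - q ^+ k).
  by rewrite mulrBr mulr1 /q exprVn -exprM mul2n -addnn exprD invfM mulrA divff ?mul1r // expf_neq0.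
rewrite !E !exprMn -!exprM mulnC ler_pM2l ?exprn_gt0 //.
have qk0 k : 0 <= 1 - q ^+ k by rewrite subr_ge0 exprn_ile1.
apply: (@le_trans _ _ ((1 - q ^+ l) ^+ l)).
  by apply: ler_wiXn2l => //; rewrite gerBl exprn_ge0.
by apply: lerXn2r; rewrite ?nnegrE // lerD2l lerN2 ler_wiXn2l.
Qed.

(** * The roots X_i and a lower bound for them *)

Section Analysis.
Variable R : realType.
Local Notation pi := (@pi R).
Local Notation lam := (path_eigenvalue R).
Local Notation cheb := (cheb R).

Definition half_sin l i : R := sin (pi * i%:R / l%:R / 2).

(** With [lam] = 4 s^2, the equation X + 1/X = 2 + [lam] says that sqrt X - 1/sqrt X = 2 s, whose
    positive solution is sqrt X = s + sqrt (1 + s^2). *)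
Definition lead_root l i : R := (half_sin l i + Num.sqrt (1 + half_sin l i ^+ 2)) ^+ 2.

Lemma lamE l i : lam l i = 4 * half_sin l i ^+ 2.
Proof.
rewrite /path_eigenvalue /half_sin; set t := _ / l%:R.
have -> : cos t = cos ((t / 2) *+ 2) by congr cos; field.
by rewrite cos_mulr2n cos2sin2; ring.
Qed.

Lemma lead_root_inv l i : (lead_root l i)^-1 =
  (Num.sqrt (1 + half_sin l i ^+ 2) - half_sin l i) ^+ 2.
Proof.
rewrite /lead_root; set s := half_sin l i.
have sq : Num.sqrt (1 + s ^+ 2) ^+ 2 = 1 + s ^+ 2.
  by rewrite sqr_sqrtr // addr_ge0 ?sqr_ge0.
apply: (@mulr1_eq _ _ _) => //.
rewrite -exprMn [X in X ^+ 2](_ : _ = 1) ?expr1n //.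
by rewrite mulrC [s + _]addrC -subr_sqr sq; ring.
Qed.

Lemma lead_root_add l i : lead_root l i + (lead_root l i)^-1 = 2 + lam l i.
Proof.
rewrite lead_root_inv lamE /lead_root; set s := half_sin l i.
have sq : Num.sqrt (1 + s ^+ 2) ^+ 2 = 1 + s ^+ 2.
  by rewrite sqr_sqrtr // addr_ge0 ?sqr_ge0.
by rewrite sqrrD sqrrB sq; ring.
Qed.

(* Discrete Jordan inequality: k |-> sin (k * t) is concave on 0 <= k <= l
   since its second difference is (2 * cos t - 2) * sin (k * t). *)
Lemma half_sin_ge l i : (0 < l)%N -> (i <= l)%N -> i%:R / l%:R <= half_sin l i.
Proof.
move=> l0 il; pose t : R := pi / l%:R / 2.
have pi0 := pi_gt0 R; have l0' : 0 < l%:R :> R by rewrite ltr0n.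
have hsE k : half_sin l k = sin (k%:R * t).
  by rewrite /half_sin /t; congr sin; field; rewrite gt_eqF.
have t0 : 0 < t by rewrite !divr_gt0.
have fl : sin (l%:R * t) = 1.
  by rewrite -[RHS]sin_pihalf /t; congr sin; field; rewrite gt_eqF.
have f0 k : (k <= l)%N -> 0 <= sin (k%:R * t).
  move=> kl; apply: sin_ge0_pi; apply/andP; split; first by rewrite mulr_ge0 // ltW.
  apply: (@le_trans _ _ (l%:R * t)).
    by rewrite ler_pM2r // ler_nat.
  rewrite /t (_ : l%:R * _ = pi / 2); last by field; rewrite gt_eqF.
  by lra.
(* This says that sin (k t) / k is nonincreasing, cross-multiplied so that the induction can start
   at k = 0. *)
have decr k : (k < l)%N -> k%:R * sin (k.+1%:R * t) <= k.+1%:R * sin (k%:R * t).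
  elim: k => [|k IH] kl; first by rewrite !mul0r sin0 mulr0.
  have := IH (ltnW kl); have := f0 _ (ltnW kl).
  have -> : k.+2%:R * t = k.+1%:R * t + t by rewrite -natr1; ring.
  have -> : k%:R * t = k.+1%:R * t - t by rewrite -natr1; ring.
  rewrite sinB sinD -!natr1.
  set X := _ * t; have := cos_le1 t.
  move: (sin X) (cos X) (cos t) (sin t) => S C c s.
  move=> c1 S0 IHk; have k0 : 0 <= k%:R :> R by [].
  have : 0 <= (k%:R + 1) * (S * (1 - c)) by apply: mulr_ge0; [lra | apply: mulr_ge0 => //; lra].
  by nra.
have mono j : (i <= j)%N -> (j <= l)%N -> i%:R * sin (j%:R * t) <= j%:R * sin (i%:R * t).
  case: (posnP i) => [-> _ _|i0]; first by rewrite !mul0r sin0 mulr0.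
  elim: j => [|j IH]; first by rewrite leqNgt i0.
  rewrite leq_eqVlt => /orP[/eqP -> //|ij] jl.
  have {}IH := IH ij (ltnW jl); have D := decr _ jl.
  have j0 : 0 < j%:R :> R by rewrite ltr0n (leq_trans i0).
  rewrite -(ler_pM2l j0) mulrCA.
  apply: le_trans (ler_wpM2l _ D) _ => //.
  rewrite mulrCA [leRHS]mulrCA; apply: ler_wpM2l => //.
rewrite ler_pdivrMr // hsE mulrC; have := mono l il (leqnn l).
by rewrite fl mulr1.
Qed.

Lemma lead_root_ge l i : (0 < l)%N -> (i <= l)%N ->
  (1 + i%:R / l%:R) ^+ 2 <= lead_root l i.
Proof.
move=> l0 il; have h := half_sin_ge l0 il; have q0 : 0 <= i%:R / l%:R :> R by rewrite divr_ge0.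
apply: lerXn2r; rewrite ?nnegrE ?addr_ge0 ?sqrtr_ge0 //; first exact: le_trans h.
rewrite addrC; apply: lerD => //.
by rewrite -[leLHS]sqrtr1 ler_sqrt ?addr_ge0 ?sqr_ge0 // lerDl sqr_ge0.
Qed.

Lemma lead_root_gt1 l i : (0 < i)%N -> (i <= l)%N -> 1 < lead_root l i.
Proof.
move=> i0 il; have l0 := leq_trans i0 il; apply: lt_le_trans (lead_root_ge l0 il).
have q0 : 0 < i%:R / l%:R :> R by rewrite divr_gt0 ?ltr0n.
by rewrite exprn_egt1 // ltrDl.
Qed.

End Analysis.

(** * Two-sided bounds for the squared count *)

Section Bounds.
Variable R : realType.
Local Notation lam := (path_eigenvalue R).
Local Notation X := (lead_root R).

Definition silver : R := (1 + Num.sqrt 2) ^+ 2.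

Lemma silver_add_inv : silver + silver^-1 = 6.
Proof.
have sq : Num.sqrt 2 ^+ 2 = 2 :> R by rewrite sqr_sqrtr.
have -> : silver^-1 = (Num.sqrt 2 - 1) ^+ 2.
  apply: mulr1_eq; rewrite /silver -exprMn mulrC [1 + _]addrC -subr_sqr sq; ring.
by rewrite /silver sqrrD sqrrB sq; ring.
Qed.

Lemma silver_ge5 : 5 <= silver.
Proof.
have s1 : 1 <= Num.sqrt 2 :> R by rewrite -[leLHS]sqrtr1 ler_sqrt // ler1n.
have sq : Num.sqrt 2 ^+ 2 = 2 :> R by rewrite sqr_sqrtr.
by rewrite /silver sqrrD sq; lra.
Qed.

Lemma silver_gt0 : 0 < silver.
Proof. by apply: lt_le_trans silver_ge5. Qed.

Lemma silver_gt1 : 1 < silver.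
Proof. by apply: lt_le_trans silver_ge5; rewrite ltr1n. Qed.

(* This is the product of (X l i - (X l i)^-1) ^+ 2 over 1 <= i < l. *)
Definition lead_gap l : R := l%:R * (cheb R l).[6].

Lemma cheb6 l : (cheb R l).[6] * (silver - silver^-1) = silver ^+ l - silver ^- l.
Proof. by rewrite -silver_add_inv cheb_geom // gt_eqF // silver_gt0. Qed.

Lemma sub_inv_gt0 (x : R) n : 1 < x -> (0 < n)%N -> 0 < x ^+ n - x ^- n.
Proof.
move=> x1 n0; have xn : 1 < x ^+ n by rewrite exprn_egt1 // -lt0n.
by rewrite subr_gt0 (lt_trans _ xn) // invf_lt1 // (lt_trans ltr01).
Qed.

Lemma silver_sub_gt0 : 0 < silver - silver^-1.
Proof. by have := sub_inv_gt0 silver_gt1 (ltn0Sn 0); rewrite !expr1. Qed.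

Lemma cheb6_gt0 l : (0 < l)%N -> 0 < (cheb R l).[6].
Proof.
move=> l0; rewrite -(pmulr_lgt0 _ silver_sub_gt0) cheb6.
exact: sub_inv_gt0 silver_gt1 l0.
Qed.

Lemma lead_gap_gt0 l : (0 < l)%N -> 0 < lead_gap l.
Proof. by move=> l0; rewrite mulr_gt0 ?cheb6_gt0 ?ltr0n. Qed.

Lemma cheb6_le l : (cheb R l).[6] * (silver - silver^-1) <= silver ^+ l.
Proof. by rewrite cheb6 gerBl invr_ge0 exprn_ge0 // ltW // silver_gt0. Qed.

(** As n is positive, x^(-2n) is at most x^(-2). The resulting factor is free of n, as the limit in
    [growth_mono] requires. *)
Lemma sub_inv_ge (x : R) n : 1 < x -> (0 < n)%N ->
  x ^+ n * (1 - x^-1 ^+ 2) <= x ^+ n - x ^- n.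
Proof.
move=> x1 n0; have x0 : 0 < x by apply: lt_trans x1.
rewrite mulrBr mulr1 lerD2l lerN2.
have -> : x ^- n = x ^+ n * x^-1 ^+ n.*2.
  by rewrite -addnn exprD mulrA exprVn divff ?mul1r // expf_neq0 // gt_eqF.
rewrite ler_pM2l ?exprn_gt0 //; apply: ler_wiXn2l.
- by rewrite invr_ge0 ltW.
- by rewrite invf_le1 // ltW.
- by case: n n0.
Qed.

Lemma cheb6_ge l : (0 < l)%N ->
  silver ^+ l * (1 - silver^-1 ^+ 2) <= (cheb R l).[6] * (silver - silver^-1).
Proof. by move=> l0; rewrite cheb6; apply: sub_inv_ge silver_gt1 l0. Qed.

(** Here (X - 1/X)^2 = (X + 1/X)^2 - 4 = [lam] ([lam] + 4), and over 0 < i < l the products of [lam]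
    and of 4 + [lam] are l and the value of [cheb l] at 6. *)
Lemma sqr_tau_grid l m : (0 < l)%N -> (0 < m)%N ->
  (tau (grid l m))%:R ^+ 2 * lead_gap l =
  \prod_(1 <= i < l) (X l i ^+ m - X l i ^- m) ^+ 2.
Proof.
move=> l0 m0; rewrite (tau_grid_cheb R l0 m0) -prodrXl /lead_gap.
have -> : (6 : R) = 2 + 4 by ring.
rewrite -[l%:R](prod_lam R l0) -(prod_add_lam 4 l0) -!big_split /=.
rewrite !big_nat; apply: eq_bigr => i /andP[i0 il].
have X1 := lead_root_gt1 R i0 (ltnW il).
have X0 : X l i != 0 by rewrite gt_eqF // (lt_trans ltr01).
rewrite -cheb_geom // exprMn lead_root_add; congr (_ * _).
have E := lead_root_add R l i.
have -> : (X l i - (X l i)^-1) ^+ 2 = (X l i + (X l i)^-1) ^+ 2 - 4 by field.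
by rewrite E; ring.
Qed.

(* ln (growth l) is twice the trapezoidal sum of ln (X l i) over 0 <= i <= l:
   X l 0 = 1 and X l l = silver. *)
Definition growth l : R := silver * \prod_(1 <= i < l) X l i ^+ 2.

Lemma growth_gt0 l : 0 < growth l.
Proof.
rewrite mulr_gt0 ?silver_gt0 //; rewrite big_nat; apply: prodr_gt0 => i /andP[i0 il].
by rewrite exprn_gt0 // (lt_trans ltr01) // lead_root_gt1 // ltnW.
Qed.

Lemma prod_leadX l m :
  \prod_(1 <= i < l) X l i ^+ m ^+ 2 = growth l ^+ m / silver ^+ m.
Proof.
rewrite /growth exprMn mulrC mulKf; last by rewrite gt_eqF // exprn_gt0 // silver_gt0.
by rewrite -prodrXl; apply: eq_bigr => i _; rewrite exprAC.
Qed.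

Lemma sqr_tau_grid_le l m : (0 < l)%N -> (0 < m)%N ->
  (tau (grid l m))%:R ^+ 2 * lead_gap l <= growth l ^+ m / silver ^+ m.
Proof.
move=> l0 m0; rewrite sqr_tau_grid // -prod_leadX !big_nat.
apply: ler_prod => i /andP[i0 il]; have X1 := lead_root_gt1 R i0 (ltnW il).
rewrite sqr_ge0 /=; apply: lerXn2r; rewrite ?nnegrE ?(ltW (sub_inv_gt0 _ _)) //.
  by rewrite exprn_ge0 // (le_trans ler01) // ltW.
by rewrite gerBl invr_ge0 exprn_ge0 // (le_trans ler01) // ltW.
Qed.

(** The factors c have two uses: 1 - X^(-2), free of m, in the limit argument, and the exact 1 -
    X^(-2m) when l <= m. *)
Lemma sqr_tau_grid_ge l m (c : nat -> R) : (0 < l)%N -> (0 < m)%N ->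
  (forall i, (0 < i < l)%N -> 0 <= c i) ->
  (forall i, (0 < i < l)%N -> X l i ^+ m * c i <= X l i ^+ m - X l i ^- m) ->
  growth l ^+ m / silver ^+ m * (\prod_(1 <= i < l) c i) ^+ 2
    <= (tau (grid l m))%:R ^+ 2 * lead_gap l.
Proof.
move=> l0 m0 c0 cX; rewrite sqr_tau_grid // -prod_leadX -prodrXl -big_split /= !big_nat.
apply: ler_prod => i /andP[i0 il]; have X1 := lead_root_gt1 R i0 (ltnW il).
have i0l : (0 < i < l)%N by rewrite i0.
have XX : 0 <= X l i ^+ m * c i.
  by rewrite mulr_ge0 ?c0 // exprn_ge0 // (le_trans ler01) // ltW.
rewrite -exprMn sqr_ge0 /=; apply: lerXn2r; rewrite ?nnegrE //; last exact: cX.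
exact: ltW (sub_inv_gt0 _ _).
Qed.

End Bounds.

(** * Comparison of two grids of equal area *)

Section Comparison.
Variable R : realType.
Local Notation X := (lead_root R).
Local Notation growth := (growth R).
Local Notation silver := (silver R).
Local Notation lead_gap := (lead_gap R).
Local Notation t l m := ((tau (grid l m))%:R ^+ 2 : R).

(** After transposition l occurs only as an exponent, and [expn_sub_mono] applies factor by
    factor. *)
Lemma sqr_tau_grid_mono l l' n : (0 < l)%N -> (l <= l')%N -> (0 < n)%N ->
  (t l n * lead_gap n) ^+ l' <= (t l' n * lead_gap n) ^+ l.
Proof.
move=> l0 ll' n0; have l'0 := leq_trans l0 ll'.
rewrite (tau_gridC R l0 n0) (tau_gridC R l'0 n0) !sqr_tau_grid // -!prodrXl !big_nat.
apply: ler_prod => j /andP[j0 jn]; have X1 := lead_root_gt1 R j0 (ltnW jn).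
rewrite exprn_ge0 ?sqr_ge0 //= exprAC [leRHS]exprAC.
apply: lerXn2r; rewrite ?nnegrE ?exprn_ge0 ?(ltW (sub_inv_gt0 _ _)) //.
exact: expn_sub_mono.
Qed.

Lemma lead_gap_ge n : (0 < n)%N ->
  n%:R * silver ^+ n * (1 - silver^-1 ^+ 2) <= lead_gap n * (silver - silver^-1).
Proof. by move=> n0; rewrite -!mulrA ler_wpM2l // cheb6_ge. Qed.

Lemma lead_gap_le n : lead_gap n * (silver - silver^-1) <= n%:R * silver ^+ n.
Proof. by rewrite -mulrA ler_wpM2l // cheb6_le. Qed.

Lemma one_sub_inv_sqr_gt0 (x : R) : 1 < x -> 0 < 1 - x^-1 ^+ 2.
Proof.
move=> x1; have x0 : 0 < x by apply: lt_trans x1.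
by rewrite subr_gt0 exprVn invf_lt1 ?exprn_gt0 // exprn_egt1.
Qed.

(* Compare the l x n and l' x n grids as n tends to infinity. *)
Lemma growth_mono l l' : (0 < l)%N -> (l <= l')%N ->
  growth l ^+ l' <= growth l' ^+ l.
Proof.
move=> l0 ll'; have l'0 := leq_trans l0 ll'.
have D0 := silver_sub_gt0 R; have e0 := one_sub_inv_sqr_gt0 (silver_gt1 R).
set D := _ - _ in D0; set e := 1 - _ in e0.
pose C := \prod_(1 <= i < l) (1 - (X l i)^-1 ^+ 2).
have C0 : 0 < C.
  rewrite /C big_nat; apply: prodr_gt0 => i /andP[i0 il].
  exact: one_sub_inv_sqr_gt0 (lead_root_gt1 R i0 (ltnW il)).
have c0 := lead_gap_gt0 R l0; have c'0 := lead_gap_gt0 R l'0.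
(* These collect all factors free of n, which [ge_expn_bounded] discards. *)
pose k := C ^+ 2 * e / (lead_gap l * D); pose k' := (lead_gap l' * D)^-1.
have k0 : 0 < k by apply: divr_gt0; apply: mulr_gt0 => //; exact: exprn_gt0.
have k'0 : 0 < k' by rewrite invr_gt0; exact: mulr_gt0.
apply: (@ge_expn_bounded R _ _ (k ^+ l') (k' ^+ l)); rewrite ?exprn_gt0 ?growth_gt0 //.
move=> n n0.
have G0 : 0 < silver ^+ n by rewrite exprn_gt0 // silver_gt0.
have cn0 := lead_gap_gt0 R n0.
have N1 : 1 <= n%:R :> R by rewrite ler1n.
have N0 : 0 < n%:R :> R by rewrite ltr0n.
have p0 : 0 < growth l ^+ n by rewrite exprn_gt0 // growth_gt0.
have p'0 : 0 < growth l' ^+ n by rewrite exprn_gt0 // growth_gt0.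
(* Up to a bounded factor [lead_gap n] is n silver^n / D, and its silver^n cancels the one dividing
   growth^n. *)
have lo : growth l ^+ n * n%:R * k <= t l n * lead_gap n.
  have h : growth l ^+ n / silver ^+ n * C ^+ 2 <= t l n * lead_gap l.
    apply: sqr_tau_grid_ge => // i /andP[i0 il].
      by rewrite ltW // one_sub_inv_sqr_gt0 // lead_root_gt1 // ltnW.
    by apply: sub_inv_ge => //; rewrite lead_root_gt1 // ltnW.
  rewrite /k mulrA (ler_pdivrMr _ _ (mulr_gt0 c0 D0)).
  rewrite -(ler_pM2r G0).
  have -> : growth l ^+ n * n%:R * (C ^+ 2 * e) * silver ^+ n =
    (growth l ^+ n / silver ^+ n * C ^+ 2) * (n%:R * silver ^+ n * e) * silver ^+ n.
    by field; rewrite gt_eqF.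
  rewrite ler_pM2r //.
  have -> : t l n * lead_gap n * (lead_gap l * D) = t l n * lead_gap l * (lead_gap n * D) by ring.
  apply: ler_pM h (lead_gap_ge n0).
    by rewrite mulr_ge0 ?sqr_ge0 // divr_ge0 // ltW.
  by rewrite mulr_ge0 ?(ltW e0) // mulr_ge0 // ltW.
have hi : t l' n * lead_gap n <= growth l' ^+ n * n%:R * k'.
  have h := sqr_tau_grid_le R l'0 n0; have h2 := lead_gap_le n.
  rewrite /k' (ler_pdivlMr _ _ (mulr_gt0 c'0 D0)).
  have -> : t l' n * lead_gap n * (lead_gap l' * D) = t l' n * lead_gap l' * (lead_gap n * D) by ring.
  have -> : growth l' ^+ n * n%:R = growth l' ^+ n / silver ^+ n * (n%:R * silver ^+ n).
    by field; rewrite gt_eqF.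
  apply: ler_pM h h2; first exact: mulr_ge0 (sqr_ge0 _) (ltW c'0).
  exact: mulr_ge0 (ltW cn0) (ltW D0).
have lo0 : 0 <= growth l ^+ n * n%:R * k.
  exact: mulr_ge0 (mulr_ge0 (ltW p0) (ltW N0)) (ltW k0).
have step : (growth l ^+ n * n%:R * k) ^+ l' <= (growth l' ^+ n * n%:R * k') ^+ l.
  apply: (@le_trans _ _ ((t l n * lead_gap n) ^+ l')).
    by apply: lerXn2r; rewrite ?nnegrE // (le_trans lo0).
  apply: le_trans (sqr_tau_grid_mono l0 ll' n0) _.
  have W0 := mulr_ge0 (sqr_ge0 (tau (grid l' n))%:R) (ltW cn0).
  by apply: lerXn2r; rewrite ?nnegrE ?(le_trans _ hi).
have Nl : n%:R ^+ l <= n%:R ^+ l' :> R by rewrite ler_weXn2l.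
rewrite -(ler_pM2r (exprn_gt0 l N0)) exprAC [X in _ <= X * _ * _]exprAC.
apply: le_trans (_ : _ <= (growth l ^+ n) ^+ l' * k ^+ l' * n%:R ^+ l') _.
  apply: ler_wpM2l Nl; exact: mulr_ge0 (exprn_ge0 _ (ltW p0)) (exprn_ge0 _ (ltW k0)).
by rewrite mulrAC [leRHS]mulrAC -!exprMn.
Qed.

(** By Bernoulli and l <= m, X_i^(2m) >= (1 + i/l)^(4m) >= (1 + i)^4 >= 4 i (i + 1). The reciprocals
    telescope: 1 minus their sum over 0 < i < k is 3/4 + 1/(4k), the bound carried by the
    induction. *)
Lemma prod_one_sub_ge l m : (0 < l)%N -> (l <= m)%N ->
  3 / 4 <= \prod_(1 <= i < l) (1 - (X l i)^-1 ^+ (2 * m)).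
Proof.
move=> l0 lm.
have bound i : (0 < i)%N -> (i < l)%N ->
    (X l i)^-1 ^+ (2 * m) <= (4 * i%:R * i.+1%:R)^-1.
  move=> i0 il; have i0' : 0 < i%:R :> R by rewrite ltr0n.
  have l0' : 0 < l%:R :> R by rewrite ltr0n.
  have X0 : 0 < X l i by rewrite (lt_trans ltr01) // lead_root_gt1 // ltnW.
  have Xm0 : 0 < X l i ^+ (2 * m) := exprn_gt0 _ X0.
  rewrite exprVn lef_pV2 ?posrE ?mulr_gt0 ?ltr0n //.
  pose q : R := i%:R / l%:R; have q0 : 0 <= q by rewrite divr_ge0.
  have bern k : 1 + k%:R * q <= (1 + q) ^+ k.
    elim: k => [|k IH]; first by rewrite mul0r addr0 expr0.
    have r0 : 0 <= 1 + q by rewrite addr_ge0.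
    rewrite exprS; apply: le_trans (ler_wpM2l r0 IH); rewrite -natr1.
    have : 0 <= k%:R * q ^+ 2 by rewrite mulr_ge0 ?sqr_ge0.
    by lra.
  have hq : 1 + i%:R <= (1 + q) ^+ m.
    apply: (@le_trans _ _ ((1 + q) ^+ l)); last by rewrite ler_weXn2l // lerDl.
    by have := bern l; rewrite /q mulrC divfK // gt_eqF.
  have : (1 + i%:R) ^+ 4 <= X l i ^+ (2 * m).
    apply: (@le_trans _ _ (((1 + q) ^+ 2) ^+ (2 * m))).
      rewrite -exprM mulnA mulnC exprM.
      by apply: lerXn2r; rewrite ?nnegrE ?exprn_ge0 ?addr_ge0.
    apply: lerXn2r; rewrite ?nnegrE ?sqr_ge0 ?(ltW X0) //.
    by rewrite /q; apply: lead_root_ge => //; apply: ltnW.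
  apply: le_trans; rewrite -natr1.
  have i1 : 1 <= i%:R :> R by rewrite ler1n.
  by nra.
suff H k : (0 < k)%N -> (k <= l)%N ->
    3 / 4 + (4 * k%:R)^-1 <= \prod_(1 <= i < k) (1 - (X l i)^-1 ^+ (2 * m)).
  by apply: le_trans _ (H l l0 (leqnn l)); rewrite lerDl invr_ge0 mulr_ge0.
elim: k => [//|k IH] _ kl; case: (posnP k) => [->|k0].
  by rewrite big_geq //; lra.
rewrite big_nat_recr //=; have {}IH := IH k0 (ltnW kl).
have k0' : 1 <= k%:R :> R by rewrite ler1n.
have kS : k.+1%:R = k%:R + 1 :> R by rewrite natr1.
have B := bound k k0 kl.
set a := _ ^+ (2 * m) in B *; set p := \prod_(_ <= _ < _) _ in IH *.
have d0 : 0 < (4 * k%:R * k.+1%:R)^-1 :> R by rewrite invr_gt0 ?mulr_gt0 ?ltr0n.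
have d1 : (4 * k%:R * k.+1%:R)^-1 <= 1 :> R.
  rewrite invf_le1 ?mulr_gt0 ?ltr0n // kS.
  by have := mulr_ge0 (le_trans ler01 k0') (le_trans ler01 k0'); lra.
apply: (@le_trans _ _ ((3 / 4 + (4 * k%:R)^-1) * (1 - (4 * k%:R * k.+1%:R)^-1))); last first.
  apply: ler_pM IH _; last by rewrite lerD2l lerN2.
  - by rewrite addr_ge0 ?divr_ge0 ?invr_ge0 ?mulr_ge0.
  - by rewrite subr_ge0.
have -> : (4 * k.+1%:R)^-1 = (4 * k%:R)^-1 - (4 * k%:R * k.+1%:R)^-1 :> R.
  by rewrite kS; field; rewrite !gt_eqF //; lra.
(* Hence 3/4 + 1/(4k) is at most 1, and multiplying it by 1 - y costs at most y. *)
have x4 : (4 * k%:R)^-1 <= 4^-1 :> R by rewrite lef_pV2 ?posrE //; lra.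
have x0 : 0 <= 4^-1 - (4 * k%:R)^-1 :> R by rewrite subr_ge0.
have := mulr_ge0 (ltW d0) x0.
by move: (4 * k%:R)^-1 (4 * k%:R * k.+1%:R)^-1 => x y; lra.
Qed.

(** Equal areas turn the m'-th power of [growth_mono] into the l-th power of the claim. *)
Lemma growth_le l l' m m' : (0 < l)%N -> (l <= l')%N -> (l * m = l' * m')%N ->
  growth l ^+ m <= growth l' ^+ m'.
Proof.
move=> l0 ll' E.
have g0 k n : 0 <= growth k ^+ n by rewrite exprn_ge0 // ltW // growth_gt0.
rewrite -(ler_pXn2r l0) ?nnegrE // [leRHS]exprAC.
have -> : (growth l ^+ m) ^+ l = (growth l ^+ l') ^+ m' by rewrite -!exprM mulnC E.
by apply: lerXn2r; rewrite ?nnegrE ?growth_mono.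
Qed.

Lemma sqr_tau_grid_ge_balanced l m : (0 < l)%N -> (l <= m)%N ->
  9 / 16 * (growth l ^+ m / silver ^+ m) <= t l m * lead_gap l.
Proof.
move=> l0 lm; have m0 := leq_trans l0 lm; have P := prod_one_sub_ge l0 lm.
apply: (@le_trans _ _ (growth l ^+ m / silver ^+ m *
   (\prod_(1 <= i < l) (1 - (X l i)^-1 ^+ (2 * m))) ^+ 2)).
  rewrite mulrC; apply: ler_wpM2l.
    by rewrite divr_ge0 // exprn_ge0 // ltW // ?growth_gt0 ?silver_gt0.
  have -> : 9 / 16 = (3 / 4) ^+ 2 :> R by field.
  have q0 : 0 <= 3 / 4 :> R by rewrite divr_ge0.
  by apply: lerXn2r; rewrite ?nnegrE ?(le_trans q0).
apply: sqr_tau_grid_ge => // i /andP[i0 il]; have X1 := lead_root_gt1 R i0 (ltnW il).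
  rewrite subr_ge0; apply: exprn_ile1; first by rewrite invr_ge0 (le_trans ler01) // ltW.
  by rewrite invf_le1 ?ltW // (lt_trans ltr01).
rewrite mulrBr mulr1 lerD2l lerN2 mul2n -addnn exprD mulrA exprVn divff ?mul1r //.
by apply: lt0r_neq0; apply: exprn_gt0; apply: lt_trans X1.
Qed.

Lemma perimeter_drop l m l' m' : (0 < l)%N -> (l * m = l' * m')%N ->
  (l < l')%N -> (l' <= m')%N ->
  exists2 d, (l + m = l' + m' + d)%N & (0 < d)%N /\ (l' <= l * d.+1)%N.
Proof.
move=> l0 E ll' l'm'.
have [a l'E] : exists a, l' = (l + a.+1)%N by exists (l' - l.+1)%N; lia.
have [b m'E] : exists b, m' = (l + b.+1)%N by exists (m' - l.+1)%N; lia.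
subst l' m'.
have le : (l + a.+1 + b.+1 <= m)%N by rewrite -(leq_pmul2l l0) E; nia.
exists (m - (l + a.+1 + b.+1))%N; first by lia.
have [d mE] : exists d, m = (l + a.+1 + b.+1 + d)%N.
  by exists (m - (l + a.+1 + b.+1))%N; lia.
(* Expanding the equal areas leaves l d = (l' - l) (m' - l) with both factors positive, hence d > 0
   and l' - l <= l d. *)
subst m; rewrite addnC addnK; have {E le}ld : (l * d = a.+1 * b.+1)%N by nia.
by split; [case: d ld; lia | rewrite mulnS ld; nia].
Qed.

Lemma tau_grid_le_of_lt l m l' m' : (0 < l)%N ->
  (l * m = l' * m')%N -> (l < l')%N -> (l' <= m')%N ->
  (tau (grid l m) <= tau (grid l' m'))%N.
Proof.
move=> l0 E ll' l'm'.
have l'0 := leq_trans (ltn0Sn _) ll'; have m'0 := leq_trans l'0 l'm'.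
have m0 : (0 < m)%N by case: m E; nia.
have [d dE [d0 l'd]] := perimeter_drop l0 E ll' l'm'.
have g0 := silver_gt0 R; have g5 := silver_ge5 R.
have D0 := silver_sub_gt0 R; have c0 := lead_gap_gt0 R l0; have c'0 := lead_gap_gt0 R l'0.
have e0 : 24 / 25 <= 1 - silver^-1 ^+ 2.
  have : silver^-1 <= 5^-1 by rewrite lef_pV2 ?posrE.
  have : 0 <= silver^-1 by rewrite invr_ge0 ltW.
  move: silver^-1 => z z0 z5; nra.
have gd : 5 * d%:R <= silver ^+ d.
  apply: (@le_trans _ _ (5 ^+ d)); last by apply: lerXn2r; rewrite ?nnegrE ?(ltW g0).
  rewrite -natrM -natrX ler_nat.
  by case: d d0 {dE l'd} => // d _; elim: d => // d IH; rewrite expnS; lia.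
(* The right side is at least 9 (24/25) 5 l d = 43.2 l d, while 16 l' <= 16 l (d + 1) <= 32 l d. *)
have key : 16 * l'%:R <= 9 * l%:R * (1 - silver^-1 ^+ 2) * silver ^+ d.
  have h1 : l'%:R <= l%:R * (d%:R + 1) :> R by rewrite natr1 -natrM ler_nat.
  have h2 : 24 / 25 * (5 * d%:R) <= (1 - silver^-1 ^+ 2) * silver ^+ d.
    by apply: ler_pM => //; rewrite ?divr_ge0 ?mulr_ge0.
  have lR : 0 <= l%:R :> R by [].
  have h3 := ler_wpM2l lR h2.
  have d1 : 1 <= d%:R :> R by rewrite ler1n.
  have h4 : 0 <= l%:R * (d%:R - 1) :> R by rewrite mulr_ge0 // subr_ge0.
  rewrite -2!mulrA; lra.
have gm0 : 0 < silver ^+ m := exprn_gt0 _ g0.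
have gm'0 : 0 < silver ^+ m' := exprn_gt0 _ g0.
(* Replacing [lead_gap l] by its main term l silver^l / D turns the powers of [silver] into those of
   l + m and l' + m', which differ by silver^d. *)
have key2 : 16 * lead_gap l' * silver ^+ m' <= 9 * lead_gap l * silver ^+ m.
  rewrite -(ler_pM2r D0).
  apply: (@le_trans _ _ (16 * (l'%:R * silver ^+ l') * silver ^+ m')).
    rewrite [leLHS]mulrAC ler_pM2r // -[leLHS]mulrA.
    by rewrite ler_pM2l // lead_gap_le.
  apply: (@le_trans _ _ (9 * (l%:R * silver ^+ l * (1 - silver^-1 ^+ 2)) * silver ^+ m)); last first.
    rewrite [leRHS]mulrAC ler_pM2r // -[leRHS]mulrA.
    by rewrite ler_pM2l // lead_gap_ge.
  have -> : 16 * (l'%:R * silver ^+ l') * silver ^+ m' = 16 * l'%:R * silver ^+ (l' + m').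
    by rewrite exprD; ring.
  have -> : 9 * (l%:R * silver ^+ l * (1 - silver^-1 ^+ 2)) * silver ^+ m =
      9 * l%:R * (1 - silver^-1 ^+ 2) * silver ^+ d * silver ^+ (l' + m').
    by rewrite -[RHS]mulrA -exprD addnC -dE exprD; ring.
  have gn0 : 0 < silver ^+ (l' + m') := exprn_gt0 _ g0.
  by rewrite ler_pM2r.
have up := sqr_tau_grid_le R l0 m0; have lo := sqr_tau_grid_ge_balanced l'0 l'm'.
have gr := growth_le l0 (ltnW ll') E.
have p0 : 0 < growth l' ^+ m' := exprn_gt0 _ (growth_gt0 R l').
suff: t l m <= t l' m' by rewrite -!natrX ler_nat leq_sqr.
have {}up : t l m <= growth l' ^+ m' / (silver ^+ m * lead_gap l).
  rewrite invfM mulrA ler_pdivlMr //; apply: le_trans up _.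
  by rewrite ler_pM2r // invr_gt0.
have {}lo : growth l' ^+ m' * (9 / (16 * (silver ^+ m' * lead_gap l'))) <= t l' m'.
  rewrite -(ler_pM2r c'0); apply: le_trans lo; rewrite le_eqVlt; apply/orP; left; apply/eqP.
  by field; rewrite (gt_eqF gm'0) (gt_eqF c'0).
apply: le_trans up (le_trans _ lo).
rewrite ler_pM2l // ler_pdivlMr; last exact: mulr_gt0 (mulr_gt0 gm'0 c'0).
rewrite mulrC ler_pdivrMr; last exact: mulr_gt0.
by rewrite [silver ^+ m' * _]mulrC [silver ^+ m * _]mulrC [leLHS]mulrA [leRHS]mulrA.
Qed.

End Comparison.

Local Close Scope ring_scope.

Theorem theorem1p2 (l m l' m' : nat)
  (hl : 0 < l) (hm : 0 < m) (hl' : 0 < l') (hm' : 0 < m')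
  (hlm : l * m = l' * m')
  (hll' : l <= l') (hl'm' : l' <= m') (hm'm : m' <= m) :
  tau (grid l m) <= tau (grid l' m').
Proof.
move: hll'; rewrite leq_eqVlt => /orP[/eqP ll'|ll'].
  by move: hlm; rewrite ll' => /eqP; rewrite eqn_pmul2l // => /eqP ->.
(* The real field is only an instrument of the proof; the standard reals are taken. *)
exact: (tau_grid_le_of_lt Rdefinitions.R hl hlm ll' hl'm').
Qed.
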